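(* Let $n\ge1$ be an integer, $\delta\ge 0$, and set $\delta_n=(15n+2\log_2((n+1)!))\delta$. Let $\mathbb K$ be a field and let the group $G$ act by isometries on a $\delta$-hyperbolic space $\mathcal H$, with basepoint $o$, with minimal displacement $>4\delta_n+(10+2n)\delta$. If $\xi_1,\dots,\xi_n\in\mathbb K[G]$ and there is a non-zero $(\alpha_1,\dots,\alpha_n)\in\mathbb K[G]^n$ such that $$\Big|\sum_i\alpha_i\xi_i\Big|<\max_i|\alpha_i\xi_i|-\delta_n,$$ then, up to re-ordering $\xi_1,\dots,\xi_n$, there exist $\beta_2,\dots,\beta_n$ in $\mathbb K[G]$ such that $$\mathrm{diam}\Big(\xi_1+\sum_{i=2}^n\beta_i\xi_i\Big)<\mathrm{diam}(\xi_1)-\delta.$$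
   Context: Distances in a metric space are written $|p-q|$, and the Gromov product is $\langle p,q\rangle_r=\tfrac12(|p-r|+|q-r|-|p-q|)$. A $\delta$-hyperbolic space is a nonempty geodesic metric space such that (i) $\langle p,q\rangle_r\ge\min(\langle p,s\rangle_r,\langle s,q\rangle_r)-\delta$ for all points $p,q,r,s$; and (ii) all geodesic triangles are $\delta$-thin: if $p(t),q(t)$ are arc length parametrizations, starting at $r$, of geodesics $[r,p]$ and $[r,q]$, then $|p(t)-q(t)|\le\delta$ for $0\le t\le\langle p,q\rangle_r$. The minimal displacement of an isometric action of $G$ on $\mathcal H$ is $\inf_{g\in G\setminus\{1\},\,p\in\mathcal H}|g\cdot p-p|$. Write $|p|=|p-o|$ for $p\in\mathcal H$. For $\xi=\sum_{g\in G}\lambda^g g\in\mathbb K[G]$, its geometric support is the finite set $\mathcal X=\{g\cdot o\mid\lambda^g\ne0\}\subset\mathcal H$, its absolute value is $|\xi|=\max_{p\in\mathcal X}|p|$, and its diameter is $\mathrm{diam}(\xi)=\max_{p,q\in\mathcal X}|p-q|$; by convention $\mathrm{diam}(0)=|0|=-\infty$. *)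

(* Defs.v *)
From HB Require Import structures.
From mathcomp Require Import all_boot all_order all_algebra.
From mathcomp Require Import finmap monalg.
From mathcomp Require Import boolp classical_sets reals constructive_ereal.
From mathcomp Require Import ereal topology exp.

Set Implicit Arguments.
Unset Strict Implicit.
Unset Printing Implicit Defensive.

Import Order.TTheory GRing.Theory Num.Theory.

Local Open Scope ring_scope.

(* The additive group of finitely supported functions G -> K is {malg K[G]};
   monalg only puts a product on it over conical monoids (x * y = 1 forces
   x = y = 1), which excludes non-trivial groups, hence this alias. *)
Definition group_ring (K : nzRingType) (G : groupType) : Type := {malg K[G]}.

Section GroupRing.
Context (K : nzRingType) (G : groupType).

HB.instance Definition _ := GRing.Lmodule.on (group_ring K G).

Local Notation KG := (group_ring K G).
Implicit Types (x y z : KG) (g h : G).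

Definition gr_one : KG := << 1 *g 1%g >>.

Definition gr_mul x y : KG :=
  \sum_(g <- msupp x) \sum_(h <- msupp y) << x@_g * y@_h *g (g * h)%g >>.

Lemma gr_mulw (d1 d2 : {fset G}) x y :
  (msupp x `<=` d1)%fset -> (msupp y `<=` d2)%fset ->
  gr_mul x y = \sum_(g <- d1) \sum_(h <- d2) << x@_g * y@_h *g (g * h)%g >>.
Proof.
move=> le_d1 le_d2; rewrite /gr_mul (big_fset_incl _ le_d1) /=.
  apply/eq_bigr=> k1 _; apply/big_fset_incl => // k _ /mcoeff_outdom ->.
  by rewrite mulr0 monalgU0.
move=> k _ /mcoeff_outdom g1k.
by rewrite big1 => // k' _; rewrite g1k mul0r monalgU0.
Qed.

Lemma gr_mulDl : left_distributive gr_mul +%R.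
Proof.
move=> x y z.
rewrite (gr_mulw (msuppD_le x y) (fsubset_refl (msupp z))).
rewrite (gr_mulw (fsubsetUl _ (msupp y)) (fsubset_refl (msupp z))).
rewrite (gr_mulw (fsubsetUr (msupp x) _) (fsubset_refl (msupp z))).
rewrite -big_split /=; apply/eq_bigr=> g _.
rewrite -big_split /=; apply/eq_bigr=> h _.
by rewrite mcoeffD mulrDl monalgUD.
Qed.

Lemma gr_mulDr : right_distributive gr_mul +%R.
Proof.
move=> z x y.
rewrite (gr_mulw (fsubset_refl (msupp z)) (msuppD_le x y)).
rewrite (gr_mulw (fsubset_refl (msupp z)) (fsubsetUl _ (msupp y))).
rewrite (gr_mulw (fsubset_refl (msupp z)) (fsubsetUr (msupp x) _)).
rewrite -big_split /=; apply/eq_bigr=> g _.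
rewrite -big_split /=; apply/eq_bigr=> h _.
by rewrite mcoeffD mulrDr monalgUD.
Qed.

Lemma gr_mul0r : left_zero 0 gr_mul.
Proof. by move=> x; rewrite /gr_mul msupp0 big_seq_fset0. Qed.

Lemma gr_mulr0 : right_zero 0 gr_mul.
Proof.
by move=> x; rewrite /gr_mul big1 // => g _; rewrite msupp0 big_seq_fset0.
Qed.

Lemma gr_mulUU (a b : K) g h :
  gr_mul << a *g g >> << b *g h >> = << a * b *g (g * h)%g >>.
Proof. by rewrite (gr_mulw msuppU_le msuppU_le) !big_seq_fset1 !mcoeffUU. Qed.

Lemma gr_mulUr (a : K) g y :
  gr_mul << a *g g >> y = \sum_(h <- msupp y) << a * y@_h *g (g * h)%g >>.
Proof.
rewrite (gr_mulw msuppU_le (fsubset_refl _)) big_seq_fset1.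
by apply/eq_bigr => h _; rewrite mcoeffUU.
Qed.

Lemma gr_mulrU (b : K) h x :
  gr_mul x << b *g h >> = \sum_(g <- msupp x) << x@_g * b *g (g * h)%g >>.
Proof.
rewrite (gr_mulw (fsubset_refl _) msuppU_le); apply/eq_bigr => g _.
by rewrite big_seq_fset1 mcoeffUU.
Qed.

Lemma gr_mulEl x y :
  gr_mul x y = \sum_(g <- msupp x) gr_mul << x@_g *g g >> y.
Proof. by apply/eq_bigr=> g _; rewrite gr_mulUr. Qed.

Lemma gr_mulEr x y :
  gr_mul x y = \sum_(h <- msupp y) gr_mul x << y@_h *g h >>.
Proof.
by rewrite {1}/gr_mul exchange_big; apply/eq_bigr=> h _; rewrite gr_mulrU.
Qed.

Lemma gr_mul1r : left_id gr_one gr_mul.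
Proof.
move=> x; rewrite gr_mulUr [RHS]monalgE.
by apply/eq_bigr=> g _; rewrite mul1r mul1g.
Qed.

Lemma gr_mulr1 : right_id gr_one gr_mul.
Proof.
move=> x; rewrite gr_mulrU [RHS]monalgE.
by apply/eq_bigr=> g _; rewrite mulr1 mulg1.
Qed.

Lemma gr_mulA : associative gr_mul.
Proof.
move=> x y z.
rewrite [RHS](big_morph (gr_mul^~ _) (fun _ _ => gr_mulDl _ _ _) (gr_mul0r _)).
rewrite gr_mulEl; apply/eq_bigr=> g _.
rewrite [LHS](big_morph (gr_mul _) (fun _ _ => gr_mulDr _ _ _) (gr_mulr0 _)).
rewrite [RHS](big_morph (gr_mul^~ _) (fun _ _ => gr_mulDl _ _ _) (gr_mul0r _)).
apply/eq_bigr=> h _.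
rewrite [LHS](big_morph (gr_mul _) (fun _ _ => gr_mulDr _ _ _) (gr_mulr0 _)).
by rewrite gr_mulEr; apply/eq_bigr=> k _; rewrite !gr_mulUU mulrA mulgA.
Qed.

Lemma gr_one_neq0 : gr_one != 0.
Proof. by rewrite monalgU_eq0 oner_eq0. Qed.

HB.instance Definition _ := GRing.Zmodule_isNzRing.Build (group_ring K G)
  gr_mulA gr_mul1r gr_mulr1 gr_mulDl gr_mulDr gr_one_neq0.

End GroupRing.

Section Hyperbolic.
Context {R : realType}.
Implicit Types (H : metricType R).

Definition gromov_product H (p q r : H) : R :=
  (mdist p r + mdist q r - mdist p q) / 2.

(* c, restricted to [0, |p - q|], is the arc length parametrization, starting
   at p, of a geodesic [p, q]; the values of c elsewhere are irrelevant. *)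
Definition is_geodesic H (p q : H) (c : R -> H) : Prop :=
  [/\ c 0 = p, c (mdist p q) = q
    & forall s t, 0 <= s <= mdist p q -> 0 <= t <= mdist p q ->
        mdist (c s) (c t) = `|s - t|].

Definition hyperbolic (delta : R) H : Prop :=
  [/\ exists p : H, True,
      forall p q : H, exists c, is_geodesic p q c,
      forall p q r s : H,
        Num.min (gromov_product p s r) (gromov_product s q r) - delta
          <= gromov_product p q r
    & forall (p q r : H) (cp cq : R -> H),
        is_geodesic r p cp -> is_geodesic r q cq ->
        forall t, 0 <= t <= gromov_product p q r ->
          mdist (cp t) (cq t) <= delta].

Definition isometric_action (G : groupType) H (act : G -> H -> H) : Prop :=
  [/\ forall p, act 1%g p = p,
      forall g h p, act (g * h)%g p = act g (act h p)
    & forall g p q, mdist (act g p) (act g q) = mdist p q].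

(* Extended-real valued, so that it is +oo for the trivial group. *)
Definition min_displacement (G : groupType) H (act : G -> H -> H) : \bar R :=
  ereal_inf [set (mdist (act g p) p)%:E |
               g in [set g : G | g != 1%g] & p in [set: H]]%classic.

Section Support.
Context (K : nzRingType) (G : groupType) (H : metricType R).
Variables (act : G -> H -> H) (o : H).
Implicit Types xi : group_ring K G.

Definition geom_support xi : {fset H} :=
  [fset act g o | g in msupp xi]%fset.

Definition gr_abs xi : \bar R :=
  \big[maxe/-oo%E]_(p <- geom_support xi) (mdist p o)%:E.

Definition gr_diam xi : \bar R :=
  \big[maxe/-oo%E]_(p <- geom_support xi)
    \big[maxe/-oo%E]_(q <- geom_support xi) (mdist p q)%:E.

End Support.

Definition log2 (x : R) : R := ln x / ln 2.

Definition delta_ (delta : R) (n : nat) : R :=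
  (15 * n%:R + 2 * log2 (n.+1)`!%:R) * delta.

End Hyperbolic.

(* Main.v *)
Require Import Defs.
From mathcomp Require Import all_boot all_order all_algebra all_fingroup.
From mathcomp Require Import finmap monalg.
From mathcomp Require Import boolp classical_sets reals constructive_ereal.
From mathcomp Require Import ereal topology exp.
From mathcomp Require Import lra zify.

Set Implicit Arguments.
Unset Strict Implicit.
Unset Printing Implicit Defensive.

Import Order.TTheory GRing.Theory Num.Theory.
Local Open Scope ring_scope.

(**
Each product [alpha i * xi i] is a combination of the translates
[g xi_i], [g] in the support of [alpha i]. Let [rho] be the largest distance
from [o] to a point of such a translate; the hypothesis says that every point
at distance at least [rho - delta_n] from [o] cancels in the total sum. For
[0 <= T <= delta_n] call a point high when its distance to [o] is at least
[rho - T], link two translates that share a high point, and let [C_T] be the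
component of a translate that reaches the distance [rho]. No translate outside
[C_T] contains a high point of [C_T], so the high points already cancel in the
partial sum over [C_T] (cluster_sum_support).

Suppose first that the space is a tree. Let a translate of diameter [d] have
farthest point [x] at distance [r] from [o], and put [phi = r - d]. A high
point of that translate is at distance at most [d] from [x], so the geodesics
from [o] to the two points agree up to the height [(rho - T + phi) / 2]. Taking
the minimum [phi_min] over [C_T], all high points of [C_T] lie beyond a single
point [b] at height [(rho - T + phi_min) / 2], and all the points of [C_T] that
are not high lie in the ball of radius [(rho - T - phi_min) / 2] around [b].
The partial sum over [C_T] therefore has diameter at most [rho - T - phi_min],
to be compared with [d = r - phi_min] for the translate [q] that attains the
minimum. The diameter has dropped if [r] exceeds [rho - T] by a definite
amount. If moreover no other translate in [C_T] has the index [i0] of [q], then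
the translate [q] can be moved back to [xi i0] by a unit of the group ring, and
the other terms only involve the other [xi i].

Two translates of the same [xi i] that branch off late enough have centers
(midpoints of a diametral pair) that are close to each other, so the
displacement hypothesis makes them equal (lvl_sep); this gives the uniqueness
of [q]. To find a level with a gap, let [N(m)] be the number of indices
occurring in [C_T] for [T = delta_m]. For the least [m] with [N(m) <= m] the
sets of indices at the levels [delta_(m-1)] and [delta_m] coincide, so [q], the
only translate of its index, is present at the previous level already and
[r >= rho - delta_(m-1)] (stable_level).

In a hyperbolic space the only loss is that Gromov products deteriorate along
a chain of links, by [delta] times the base 2 logarithm of its length. Chains
in [C_T] can be long. But translates of large [phi] have Gromov products that
exceed the required bound by more than even a crude linear loss, while those of
nearly minimal [phi] are pairwise of distinct index, so at most [N(m)] of them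
matter (gp_connect_linear, gp_connect_log). The resulting loss,
[14 + 2 log2(m)] in units of [delta], is what the step from [delta_(m-1)] to
[delta_m] pays for.
*)

(** * Gromov products along chains *)

Lemma connect_invariant (V : finType) (e : rel V) (Inv : V -> Prop) a b :
  (forall u w, Inv u -> e u w -> Inv w) -> Inv a -> connect e a b -> Inv b.
Proof.
move=> stable Inva /connectP[p].
elim: p a Inva => [|c p IHp] a Inva /=; first by move=> _ ->.
by case/andP=> eac; apply: IHp; apply: stable eac.
Qed.

Definition induced (V : finType) (e : rel V) (W : {set V}) : rel V :=
  [rel a b | [&& a \in W, b \in W & e a b]].

Lemma induced_connect_sym (V : finType) (e : rel V) (W : {set V}) :
  symmetric e -> connect_sym (induced e W).
Proof.
by move=> e_sym; apply: sym_connect_sym => a b; rewrite /induced /= e_sym andbCA.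
Qed.

Lemma induced_connect_in (V : finType) (e : rel V) (W : {set V}) a b :
  a \in W -> connect (induced e W) a b -> b \in W.
Proof.
by apply: (connect_invariant (Inv := fun v => v \in W)) => u w _ /and3P[].
Qed.

(** In this section [gp] stands for the Gromov product at a base point, the
vertices [v] carry a point [x v], a height [f v] and a label [idx v]. A link
certifies that the two points agree, as seen from the base point, up to the
smaller of their heights; two vertices with the same label whose points agree
almost up to the smaller height coincide. The aim is to bound [gp] below by the
minimal height for all pairs in a connected set, with an error controlled by
the number of labels only. *)
Section Linkage.
Variables (R : realFieldType) (V I : finType) (P : Type).
Variables (gp : P -> P -> R) (delta : R).
Implicit Types lo : R.
Hypothesis delta_ge0 : 0 <= delta.
Hypothesis gpC : forall p q, gp p q = gp q p.
Hypothesis gp_hyp : forall p q s, Num.min (gp p s) (gp s q) - delta <= gp p q.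

Lemma gp_trans lo p s q : lo <= gp p s -> lo <= gp s q -> lo - delta <= gp p q.
Proof.
by move=> lops losq; apply: le_trans (gp_hyp p q s); rewrite lerD2r le_min lops.
Qed.

(** Halving the chain makes the loss logarithmic in its length. *)
Lemma gp_path (T : Type) (x : T -> P) (e : rel T) lo k a s :
    (forall b c, e b c -> lo <= gp (x b) (x c)) ->
    path e a s -> (0 < size s <= 2 ^ k)%N ->
  lo - k%:R * delta <= gp (x a) (x (last a s)).
Proof.
have d0 := delta_ge0.
move=> e_lo; elim: k a s => [|k IHk] a s path_s /andP[s_gt0 s_le].
  rewrite mul0r subr0; case: s path_s s_gt0 s_le => [|b [|c s]] //=.
  by move=> /andP[/e_lo].
have [s_le'|s_gt] := leqP (size s) (2 ^ k).
  have := IHk a s path_s; rewrite s_gt0 s_le' => /(_ isT).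
  by rewrite -natr1; lra.
move: path_s; rewrite -(cat_take_drop (2 ^ k) s) cat_path last_cat => /andP[p1 p2].
have := expn_gt0 2 k; rewrite expnS in s_le => k_gt0.
have size1 : (0 < size (take (2 ^ k) s) <= 2 ^ k)%N by rewrite size_take s_gt; lia.
have size2 : (0 < size (drop (2 ^ k) s) <= 2 ^ k)%N by rewrite size_drop; lia.
have := gp_trans (IHk _ _ p1 size1) (IHk _ _ p2 size2).
by rewrite -natr1; lra.
Qed.

Variables (x : V -> P) (f : V -> R) (idx : V -> I) (e : rel V) (S : {set V}) (D : R).
Hypothesis e_sym : symmetric e.
Hypothesis gp_self : {in S, forall v, f v <= gp (x v) (x v)}.
Hypothesis gp_edge : {in S &, forall a b, e a b ->
  exists p, f a <= gp (x a) p /\ f b <= gp p (x b)}.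
Hypothesis idx_sep : {in S &, forall a b,
  idx a = idx b -> f a <= f b -> f a - D <= gp (x a) (x b) -> a = b}.

Lemma gp_edge_le lo a b : a \in S -> b \in S -> e a b ->
  lo <= f a -> lo <= f b -> lo - delta <= gp (x a) (x b).
Proof.
move=> aS bS eab loa lob; have [p [ap pb]] := gp_edge aS bS eab.
by apply: (@gp_trans _ _ p); [apply: le_trans ap | apply: le_trans pb].
Qed.

(** A crude bound for arbitrary sets of vertices, by induction on the number
of labels. Let [q] have minimal height. Removing the label of [q] leaves pieces
with fewer labels, whose points agree almost up to the height of [q]; hence a
vertex with the label of [q] that is reached from such a piece is [q] itself. So every
vertex is joined to [q] by at most one link followed by a single piece, at the
cost of [2 delta] for each label. *)
Lemma gp_connect_linear k (W : {set V}) lo a b :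
    W \subset S -> (#|idx @: W| <= k)%N -> (k%:R * 2) * delta <= D ->
    {in W, forall v, lo <= f v} -> a \in W -> connect (induced e W) a b ->
  lo - (k%:R * 2) * delta <= gp (x a) (x b).
Proof.
have d0 := delta_ge0.
elim: k W lo a b => [|k IHk] W lo a b sWS cardW leD loW aW conab.
  move: cardW; rewrite leqn0 cards_eq0 => /eqP/finset.setP/(_ (idx a)).
  by rewrite imset_f ?inE.
pose K := [set v | connect (induced e W) a v].
have aK : a \in K by rewrite inE.
have sKW : K \subset W.
  by apply/fintype.subsetP=> v; rewrite inE; apply: induced_connect_in.
have sKS := fintype.subset_trans sKW sWS.
have [q qK qmin] : exists2 q, q \in K & {in K, forall v, f q <= f v}.
  by case: (arg_minP f aK) => q qK qmin; exists q.
pose J := [set v in K | idx v != idx q].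
have sJK : J \subset K by apply/fintype.subsetP=> v; rewrite inE => /andP[].
have cardJ : (#|idx @: J| <= k)%N.
  have: idx @: J \subset (idx @: W) :\ idx q.
    apply/fintype.subsetP=> _ /imsetP[v + ->]; rewrite !inE => /andP[vK ->].
    by rewrite imset_f // (fintype.subsetP sKW) // inE.
  move/subset_leq_card; move: cardW; rewrite (cardsD1 (idx q) (idx @: W)).
  by rewrite imset_f ?(fintype.subsetP sKW) //; lia.
have leD' : (k%:R * 2 + 2) * delta <= D by move: leD; rewrite -natr1; lra.
have k0 : 0 <= k%:R * delta by rewrite mulr_ge0.
have leD2 : k%:R * 2 * delta <= D by lra.
(* the vertices reached from [q] by a link and then a piece without the label of [q] *)
pose reached v := v = q \/
  (exists u, [/\ u \in J, e q u & connect (induced e J) u v]).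
have reachedP v : reached v -> f q - (k%:R * 2 + 1) * delta <= gp (x q) (x v).
  case=> [->|[u [uJ equ conuv]]].
    by have := gp_self (fintype.subsetP sKS _ qK); lra.
  have uK := fintype.subsetP sJK _ uJ.
  have k_ge1 : delta <= k%:R * delta.
    rewrite ler_peMl // ler1n (leq_trans _ cardJ) // card_gt0.
    by apply/finset.set0Pn; exists (idx u); rewrite imset_f.
  have := gp_edge_le (fintype.subsetP sKS _ qK) (fintype.subsetP sKS _ uK) equ (lexx _)
    (qmin _ uK).
  have := IHk J (f q) u v (fintype.subset_trans sJK sKS) cardJ leD2 _ uJ conuv.
  move=> /(_ (fun w wJ => qmin w (fintype.subsetP sJK _ wJ))) uv qu.
  have qu' : f q - k%:R * 2 * delta <= gp (x q) (x u) by lra.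
  by have := gp_trans qu' uv; lra.
have reachK v : v \in K -> reached v.
  rewrite inE => conav.
  have conqv : connect (induced e W) q v.
    apply: connect_trans conav; rewrite induced_connect_sym //.
    by move: qK; rewrite inE.
  suff [] : v \in K /\ reached v by [].
  apply: (connect_invariant (Inv := fun v => v \in K /\ reached v) _ _ conqv);
    last by split=> //; left.
  move=> u w [uK ru] euw.
  have wK : w \in K by move: uK; rewrite !inE => /connect_trans; apply; exact: connect1.
  have {}euw : e u w by case/and3P: euw.
  split=> //; have [eqi|neqi] := eqVneq (idx w) (idx q).
    left; apply/esym/idx_sep; rewrite ?(fintype.subsetP sKS) // ?qmin //.
    have := gp_edge_le (fintype.subsetP sKS _ uK) (fintype.subsetP sKS _ wK) euw
      (qmin _ uK) (qmin _ wK).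
    move=> uw; have uw' : f q - (k%:R * 2 + 1) * delta <= gp (x u) (x w) by lra.
    by have := gp_trans (reachedP _ ru) uw'; lra.
  right; have wJ : w \in J by rewrite inE wK.
  have [equ|neu] := eqVneq u q; first by exists w; rewrite -equ connect0.
  case: ru => [/eqP|[t [tJ eqt contu]]]; first by rewrite (negPf neu).
  exists t; split=> //; apply: (connect_trans contu); apply: connect1.
  have uJ := induced_connect_in tJ contu.
  by rewrite /induced /= uJ wJ.
have ra := reachedP _ (reachK _ aK).
have rb : f q - (k%:R * 2 + 1) * delta <= gp (x q) (x b).
  by apply/reachedP/reachK; rewrite inE.
rewrite gpC in ra; have := gp_trans ra rb.
have := loW _ (fintype.subsetP sKW _ qK); rewrite -natr1; lra.
Qed.

(** Call a vertex long when its height is within [(2 #|I| + 1) delta] of the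
minimum. Chains of other vertices satisfy a bound above the minimum by at least
[delta], even after the linear loss of gp_connect_linear, so they can be
short-cut. Long vertices have pairwise distinct labels, so a simple chain of
them has at most as many members as there are labels, and gp_path applies. *)
Lemma gp_connect_log k (K : {set V}) q a b :
    K \subset S -> (#|idx @: K| <= 2 ^ k)%N -> (4 * #|I|%:R + 1) * delta <= D ->
    {in K, forall v, f q <= f v} ->
    q \in K -> {in K, forall v, connect (induced e K) q v} ->
    a \in K -> b \in K ->
  f q - (k%:R + 4) * delta <= gp (x a) (x b).
Proof.
have d0 := delta_ge0.
move=> sKS cardK leD qmin qK conq aK bK.
set N : R := #|I|%:R in leD; set h := f q.
have KS v : v \in K -> v \in S by apply: (fintype.subsetP sKS).
have Nd0 : 0 <= N * delta by rewrite mulr_ge0.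
have kd0 : 0 <= k%:R * delta by rewrite mulr_ge0.
have cardI (W : {set V}) : (#|idx @: W| <= #|I|)%N by apply: max_card.
have leD2 : N * 2 * delta <= D by lra.
pose long v := (v \in K) && (f v <= h + (2 * N + 1) * delta).
pose J := [set v in K | ~~ (f v <= h + (2 * N + 1) * delta)].
have JK v : v \in J -> v \in K by rewrite inE => /andP[].
have sJS : J \subset S by apply/fintype.subsetP => v /JK/KS.
have J_lo : {in J, forall v, h + (2 * N + 1) * delta <= f v}.
  by move=> v; rewrite inE -ltNge => /andP[_ /ltW].
have edge_lo u w : u \in K -> w \in K -> e u w -> h - delta <= gp (x u) (x w).
  by move=> uK wK euw; apply: gp_edge_le; rewrite ?KS ?qmin.
have long_q : long q by rewrite /long qK /= -/h mulrDl mul1r -mulrA; lra.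
have long_inj u w : long u -> long w -> idx u = idx w -> u = w.
  wlog leuw : u w / f u <= f w => [IH lu lw eqi|].
    have [/IH->//|/ltW lewu] := leP (f u) (f w).
    by apply/esym/IH.
  move=> /andP[uK lu] /andP[wK _] eqi.
  have conuw : connect (induced e K) u w.
    by apply: connect_trans (conq _ wK); rewrite induced_connect_sym // conq.
  apply: idx_sep; rewrite ?KS //.
  have := gp_connect_linear sKS (cardI K) leD2 qmin uK conuw.
  by rewrite -/N -/h; lra.
(* the short-cuts: [2 delta] is the cost of passing through a chain of J *)
pose link := [rel u w | [&& long u, long w & h - 2 * delta <= gp (x u) (x w)]].
(* [v] is reached through J from a vertex linked to a long one *)
pose hangs v := exists u w,
  [/\ connect link q u, long u, w \in J, e u w & connect (induced e J) w v].
have hangsP v : v \in K -> hangs v ->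
    exists u, [/\ connect link q u, long u & h - delta <= gp (x u) (x v)].
  move=> vK [u [w [conqu lu wJ euw conwv]]]; exists u; split=> //.
  have uK : u \in K by case/andP: lu.
  have [p [up pw]] := gp_edge (KS _ uK) (KS _ (JK _ wJ)) euw.
  have := gp_connect_linear sJS (cardI J) leD2 J_lo wJ conwv; rewrite -/N => wv.
  have wv' : h + delta <= gp (x w) (x v) by lra.
  have pw' : h + delta <= gp p (x w) by have := J_lo _ wJ; lra.
  have pv := gp_trans pw' wv'.
  by apply: (@gp_trans _ _ p); [apply: le_trans up; exact: qmin | lra].
have reach v : connect (induced e K) q v ->
    v \in K /\ ((long v /\ connect link q v) \/ (v \in J /\ hangs v)).
  apply: (connect_invariant (Inv := fun v => v \in K /\
    ((long v /\ connect link q v) \/ (v \in J /\ hangs v)))); last first.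
    by split=> //; left.
  move=> u w [uK ru] /and3P[_ wK euw]; split=> //.
  have [lw|nlw] := boolP (long w); last first.
    have wJ : w \in J by move: nlw; rewrite /long inE wK.
    right; split=> //; case: ru => [[lu conqu]|[uJ [t [s [conqt lngt sJ ets consu]]]]].
      by exists u, w.
    exists t, s; split=> //; apply: connect_trans consu (connect1 _).
    by rewrite /induced /= uJ wJ.
  left; split=> //; case: ru => [[lu conqu]|[uJ hu]].
    apply: connect_trans conqu (connect1 _); rewrite /= lu lw.
    by have := edge_lo _ _ uK wK euw; lra.
  have [t [conqt lt tu]] := hangsP _ uK hu.
  apply: connect_trans conqt (connect1 _); rewrite /= lt lw.
  by have := gp_trans tu (edge_lo _ _ uK wK euw); lra.
have link_lo v : connect link q v -> h - (k%:R + 2) * delta <= gp (x q) (x v).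
  case/connectP=> s /shortenP[s' path_s' uniq_s' _] ->.
  case: (posnP (size s')) => [/size0nil->|s'_gt0] /=.
    by have := gp_self (KS _ qK); rewrite -/h; lra.
  have long_s' : {in q :: s', forall v, long v}.
    move=> y; rewrite inE => /predU1P[->//|].
    move: (q) path_s'; elim: (s') => [//|w t IHt] u /= /andP[/and3P[_ lw _] pt].
    by rewrite inE => /predU1P[->//|]; exact: IHt pt.
  have uniq_idx : uniq [seq idx v | v <- q :: s'].
    by rewrite map_inj_in_uniq // => u w us ws; apply: long_inj; apply: long_s'.
  have size_s' : (0 < size s' <= 2 ^ k)%N.
    rewrite s'_gt0 (leq_trans _ cardK) // ltnW //.
    have <- : size [seq idx v | v <- q :: s'] = (size s').+1 by rewrite size_map.
    rewrite -(card_uniqP uniq_idx); apply/subset_leq_card/fintype.subsetP.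
    by move=> _ /mapP[y /long_s'/andP[yK _] ->]; rewrite imset_f.
  have link_gp u w : link u w -> h - 2 * delta <= gp (x u) (x w) by case/and3P.
  by have := gp_path link_gp path_s' size_s'; lra.
have from_q v : v \in K -> h - (k%:R + 3) * delta <= gp (x q) (x v).
  move=> vK; have [_ [[_ /link_lo]|[_ hv]]] := reach _ (conq _ vK); first lra.
  have [u [conqu _ uv]] := hangsP _ vK hv.
  have uv' : h - (k%:R + 2) * delta <= gp (x u) (x v) by lra.
  by have := gp_trans (link_lo _ conqu) uv'; lra.
have := from_q _ aK; rewrite gpC => qa.
by have := gp_trans qa (from_q _ bK); lra.
Qed.

End Linkage.

(** * Products and supports in the group ring *)

Section GroupRing.
Variables (K : fieldType) (G : groupType).
Implicit Types (x y : group_ring K G) (g k : G).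

Lemma mcoeff_mulU (a : K) g y k :
  ((<< a *g g >> : group_ring K G) * y)@_k = a * y@_(g^-1 * k)%g.
Proof.
rewrite [_ * y]gr_mulUr raddf_sum /=.
have [yk|yk] := boolP ((g^-1 * k)%g \in msupp y); last first.
  rewrite (mcoeff_outdom yk) mulr0 big_seq big1 // => h hy.
  rewrite mcoeffU; case: eqP => // eqk.
  by move: yk; rewrite -eqk mulKg hy.
rewrite (big_fsetD1 _ yk) /= mulKVg mcoeffUU big_seq big1 ?addr0 // => h.
rewrite !inE => /andP[neh _]; rewrite mcoeffU; case: eqP => // eqk.
by move: neh; rewrite -eqk mulKg eqxx.
Qed.

Lemma gr_mul_sum x y :
  x * y = \sum_(g : msupp x) (<< x@_(val g) *g val g >> : group_ring K G) * y.
Proof. by rewrite [LHS]gr_mulEl big_seq_fsetE. Qed.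

Lemma msupp_mul x y k : k \in msupp (x * y) ->
  exists2 g, g \in msupp x & (g^-1 * k)%g \in msupp y.
Proof.
apply: contraTP => no_g; rewrite -mcoeff_eq0 gr_mul_sum raddf_sum /= big1 //.
move=> g _; rewrite mcoeff_mulU.
have [gy|gy] := boolP ((val g)^-1 * k \in msupp y)%g.
  by case: no_g; exists (val g) => //; exact: valP.
by rewrite (mcoeff_outdom gy) mulr0.
Qed.

End GroupRing.

Lemma seq_argmax (R : realDomainType) (T : eqType) (s : seq T) (F : T -> R) :
  s != [::] -> exists2 k, k \in s & {in s, forall k', F k' <= F k}.
Proof.
elim: s => // a s IHs _; have [->|/IHs[k ks kmax]] := eqVneq s [::].
  by exists a; rewrite ?inE // => k; rewrite inE => /eqP->.
have [le|/ltW le] := leP (F a) (F k); [exists k | exists a]; rewrite ?inE ?eqxx ?ks ?orbT //.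
  by move=> k'; rewrite inE => /predU1P[->|/kmax].
move=> k'; rewrite inE => /predU1P[->//|/kmax le'].
exact: le_trans le.
Qed.

Section Support.
Variables (R : realType) (K : fieldType) (G : groupType) (H : metricType R).
Variables (act : G -> H -> H) (o : H).
Implicit Types (x : group_ring K G).

Lemma in_geom_support x p : p \in geom_support act o x ->
  exists2 k, k \in msupp x & p = act k o.
Proof. by case/imfsetP=> k /= kx ->; exists k. Qed.

Lemma gr_abs_ge x k : k \in msupp x ->
  ((mdist (act k o) o)%:E <= gr_abs act o x)%E.
Proof.
move=> kx; apply: (@le_bigmax_seq _ _ _ _ _ (act k o)) => //.
by apply/imfsetP; exists k.
Qed.

Lemma gr_abs_le x (c : \bar R) :
  {in msupp x, forall k, (mdist (act k o) o)%:E <= c}%E -> (gr_abs act o x <= c)%E.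
Proof.
move=> le_c; rewrite /gr_abs big_seq; apply: bigmax_le; first exact: leNye.
by move=> _ /in_geom_support[k kx ->]; exact: le_c.
Qed.

Lemma gr_diam_lt x (c : R) :
  {in msupp x &, forall k k', mdist (act k o) (act k' o) < c} ->
  (gr_diam act o x < c%:E)%E.
Proof.
move=> lt_c; rewrite /gr_diam big_seq; apply: bigmax_lt; first exact: ltNyr.
move=> _ /in_geom_support[k kx ->]; rewrite big_seq.
apply: bigmax_lt; first exact: ltNyr.
by move=> _ /in_geom_support[k' kx' ->]; rewrite lte_fin lt_c.
Qed.

Lemma gr_diam_attained x : x != 0 -> exists k k',
  [/\ k \in msupp x, k' \in msupp x,
      gr_diam act o x = (mdist (act k o) (act k' o))%:E
    & {in msupp x &, forall l l',
        mdist (act l o) (act l' o) <= mdist (act k o) (act k' o)}].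
Proof.
move=> x_neq0.
pose F (u : G * G) := mdist (act u.1 o) (act u.2 o).
have [[k k'] kk' kmax] : exists2 u, u \in [seq (k, k') | k <- msupp x, k' <- msupp x]
    & {in [seq (k, k') | k <- msupp x, k' <- msupp x], forall u', F u' <= F u}.
  apply: seq_argmax; apply: contraNneq x_neq0 => supp0.
  apply/eqP/malgP => k; rewrite mcoeff0; apply/mcoeff_outdom/negP => kx.
  have : (k, k) \in [seq (k, k') | k <- msupp x, k' <- msupp x].
    by apply/allpairsP; exists (k, k).
  by rewrite supp0.
have [kx k'x] : k \in msupp x /\ k' \in msupp x.
  by case/allpairsP: kk' => -[a b] /= [ax bx [-> ->]].
have Fmax : {in msupp x &, forall l l',
    mdist (act l o) (act l' o) <= mdist (act k o) (act k' o)}.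
  by move=> l l' lx l'x; apply: (kmax (l, l')); apply/allpairsP; exists (l, l').
exists k, k'; split=> //; apply/eqP; rewrite eq_le; apply/andP; split.
  rewrite /gr_diam big_seq; apply: bigmax_le; first exact: leNye.
  move=> _ /in_geom_support[l lx ->]; rewrite big_seq.
  apply: bigmax_le; first exact: leNye.
  by move=> _ /in_geom_support[l' l'x ->]; rewrite lee_fin Fmax.
apply: (@bigmax_sup_seq _ _ _ _ _ (act k o)) => //; first by apply/imfsetP; exists k.
apply: (@bigmax_sup_seq _ _ _ _ _ (act k' o)) => //.
by apply/imfsetP; exists k'.
Qed.

End Support.

(** * Four-point geometry *)
Section Geometry.
Variables (R : realType) (H : metricType R) (delta : R).
Hypothesis delta_ge0 : 0 <= delta.
Hypothesis four_points : forall p q r s : H,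
  Num.min (gromov_product p s r) (gromov_product s q r) - delta
    <= gromov_product p q r.

Lemma gromov_productC (p q r : H) : gromov_product p q r = gromov_product q p r.
Proof. by rewrite /gromov_product [mdist p q]metric_sym; congr (_ / 2); lra. Qed.

(** Seen from [c] the Gromov product of [p] and [p'] vanishes, so one of the
points [p], [p'] has a Gromov product at most [delta] with [u]. *)
Lemma midpoint_dist (p p' c u : H) (d : R) :
  mdist p p' = d -> mdist p c = d / 2 -> mdist p' c = d / 2 ->
  mdist u c <= Num.max (mdist u p) (mdist u p') - d / 2 + 2 * delta.
Proof.
move=> pp' pc p'c; have := four_points p p' c u.
rewrite /gromov_product pp' pc p'c (metric_sym p u).
have d0 := delta_ge0; rewrite minEle maxEle.
by case: ifP => _; case: ifP => /idP le_uu; lra.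
Qed.

Lemma midpoint_exists (p p' : H) : (exists c, is_geodesic p p' c) ->
  exists c, mdist p c = mdist p p' / 2 /\ mdist p' c = mdist p p' / 2.
Proof.
case=> c [c0 c1 cE]; exists (c (mdist p p' / 2)).
have d0 : 0 <= mdist p p' by exact: mdist_ge0.
have mid : 0 <= mdist p p' / 2 <= mdist p p' by apply/andP; split; lra.
split.
  have := cE 0 _ _ mid; rewrite c0 lexx d0 => /(_ isT) ->.
  by rewrite ler0_norm; lra.
have := cE (mdist p p') _ _ mid; rewrite c1 lexx d0 => /(_ isT) ->.
by rewrite ger0_norm; lra.
Qed.

(** Here [z], [z'] are the centers of two sets of diameter [d] with farthest
points [x], [x']. The center [z] is nearly on the geodesic from [o] to [x], at
distance [d / 2] from [x], so it agrees with [x] beyond the height where [x]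
and [x'] are known to agree; the same holds for [z'], and the two centers have
nearly the same height. *)
Lemma centers_close (o x x' z z' : H) (d tau D : R) :
    mdist z x <= d / 2 + 2 * delta -> mdist z' x' <= d / 2 + 2 * delta ->
    mdist z o <= mdist x o - d / 2 + 2 * delta ->
    mdist z' o <= mdist x' o - d / 2 + 2 * delta ->
    tau <= mdist x o -> mdist x o <= mdist x' o -> 2 * delta <= D ->
    (tau + mdist x o - d) / 2 - D <= gromov_product x x' o ->
  mdist z z' <= mdist x' o - tau + 2 * D + 8 * delta.
Proof.
move=> zx z'x' zo z'o tauo xx' leD xx'o; have d0 := delta_ge0.
set h := (tau + mdist x o - d) / 2 in xx'o.
have zx' : h - D <= gromov_product z x o.
  have := metric_triangle x z o; have := metric_sym x z.
  by rewrite /h /gromov_product; lra.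
have x'z' : h - D <= gromov_product x' z' o.
  have := metric_triangle x' z' o; have := metric_sym x' z'.
  by rewrite /h /gromov_product; lra.
have xz' := gp_trans (fun p q s => four_points p q o s) xx'o x'z'.
have zx'' : h - D - delta <= gromov_product z x o by lra.
have := gp_trans (fun p q s => four_points p q o s) zx'' xz'.
rewrite /h /gromov_product; lra.
Qed.

(** In a tree, [x] and [x'] both lie beyond a point [b] at height
[(tau + phi) / 2]. A low point [q] beyond [b] is within [(tau - phi) / 2] of
[b] because it is low; a point [q] that branches off the geodesic to [x] at a
height [s] before [b] satisfies [|q - o| <= 2 s - phi] because
[|q - x| <= d]. The three possible values of the minimum [m] below are the
heights at which the geodesics from [o] to [q] and [q'] may separate. *)
Lemma low_points_close (o q q' x x' : H) (d d' tau phi E : R) :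
    mdist q o < tau -> mdist q' o < tau ->
    mdist q x <= d -> mdist q' x' <= d' ->
    phi <= mdist x o - d -> phi <= mdist x' o - d' -> 0 <= E ->
    (tau + phi) / 2 - E <= gromov_product x x' o ->
  mdist q q' < tau - phi + 2 * E + 4 * delta.
Proof.
move=> q_lt q'_lt qx q'x' phid phid' E0 xx'; have d0 := delta_ge0.
set h := (tau + phi) / 2 in xx'.
set s := gromov_product q x o; set s' := gromov_product x' q' o.
have lo : exists m, [/\ m - E - 2 * delta <= gromov_product q q' o &
    [\/ m = h, m = s | m = s']].
  pose m := Num.min h (Num.min s s'); exists m; split.
    have [mh ms ms'] : [/\ m <= h, m <= s & m <= s'].
      by rewrite /m !ge_min !lexx !orbT.
    have qx' : m - E <= gromov_product q x o by rewrite -/s; lra.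
    have xx'' : m - E <= gromov_product x x' o by lra.
    have x'q' : m - E - delta <= gromov_product x' q' o by rewrite -/s'; lra.
    have := gp_trans (fun p q s => four_points p q o s)
      (gp_trans (fun p q s => four_points p q o s) qx' xx'') x'q'.
    by lra.
  by rewrite /m; case: leP => _; [apply: Or31|case: leP => _; [apply: Or32|apply: Or33]].
have q'x'C := metric_sym x' q'.
case: lo => m []; rewrite /s /s' /h /gromov_product => le_m.
by case=> eqm; rewrite eqm in le_m; lra.
Qed.

End Geometry.

(** * The sequence of levels *)

Section Levels.
Variable R : realType.
Implicit Type delta : R.

Lemma delta_0 delta : delta_ delta 0 = 0.
Proof. by rewrite /delta_ /log2 factS fact0 ln1; lra. Qed.

Lemma log2_nat_lb k m : (2 ^ k <= m)%N -> k%:R <= log2 (m%:R : R).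
Proof.
move=> le_km; have ln2_gt0 : 0 < ln (2 : R) by rewrite ln_gt0 // ltr1n.
rewrite /log2 ler_pdivlMr // mulr_natl -lnXn // -natrX ler_ln ?posrE ?ltr0n ?ler_nat //.
  by rewrite expn_gt0.
by apply: leq_trans le_km; rewrite expn_gt0.
Qed.

Lemma delta_S delta m : delta_ delta m.+1
  = delta_ delta m + (15 + 2 * log2 m.+2%:R) * delta.
Proof.
rewrite /delta_ /log2 (factS m.+1) natrM lnM ?posrE ?ltr0n ?fact_gt0 //.
by rewrite -(natr1 m); lra.
Qed.

(** The only form in which the logarithm of the definition is needed: the
exponent [k] will be the number of halvings of a chain. *)
Lemma delta_step delta k m : 0 <= delta -> (2 ^ k <= m.+2)%N ->
  delta_ delta m + (15 + 2 * k%:R) * delta <= delta_ delta m.+1.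
Proof.
move=> d0 /log2_nat_lb le_k; rewrite delta_S lerD2l ler_wpM2r //; lra.
Qed.

Lemma delta_mono delta m n : 0 <= delta -> (m <= n)%N ->
  delta_ delta m <= delta_ delta n.
Proof.
move=> d0; elim: n => [|n IHn]; first by rewrite leqn0 => /eqP->.
rewrite leq_eqVlt => /predU1P[->//|/IHn le_mn]; apply: le_trans le_mn _.
have := @delta_step delta 0 n d0 isT; rewrite mulr0; lra.
Qed.

Lemma delta_ge15 delta n : 0 <= delta -> 15 * n%:R * delta <= delta_ delta n.
Proof.
move=> d0; elim: n => [|n IHn]; first by rewrite delta_0; lra.
have := @delta_step delta 0 n d0 isT; rewrite mulr0 -(natr1 n); lra.
Qed.

End Levels.

(** * Clusters of translates *)
Section Clusters.
Variables (R : realType) (delta : R) (K : fieldType) (G : groupType).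
Variables (H : metricType R) (act : G -> H -> H) (o : H) (n : nat).
Variables (xi alpha : 'I_n -> group_ring K G).
Implicit Types T : R.
Hypothesis delta_ge0 : 0 <= delta.
Hypothesis hypH : hyperbolic delta H.
Hypothesis isoG : isometric_action act.
(* [8 n + 10] is twice the tolerance [4 n + 1] of lvl_sep plus the [8] of
   centers_close. *)
Hypothesis displ : forall g p, g != 1%g ->
  delta_ delta n + (8 * n%:R + 10) * delta < mdist (act g p) p.

Local Notation pt k := (act k o).
Local Notation V := {i : 'I_n & msupp (alpha i)}.
Local Notation norm k := (mdist (pt k) o).

(** A vertex [v] is a pair of an index [tag v] and an element [translator v]
of the support of [alpha (tag v)]: it stands for a translate of
[xi (tag v)]. *)
Definition translator (v : V) : G := val (tagged v).
Definition coef (v : V) : K := (alpha (tag v))@_(translator v).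
Definition term (v : V) : group_ring K G :=
  (<< coef v *g translator v >> : group_ring K G) * xi (tag v).
Definition covers (v : V) (k : G) : bool :=
  ((translator v)^-1 * k)%g \in msupp (xi (tag v)).
Definition diam (i : 'I_n) : R := fine (gr_diam act o (xi i)).

Lemma coef_neq0 v : coef v != 0.
Proof. by rewrite mcoeff_neq0; exact: valP. Qed.

Lemma mcoeff_term v k : (term v)@_k = coef v * (xi (tag v))@_((translator v)^-1 * k)%g.
Proof. exact: mcoeff_mulU. Qed.

Lemma term_notcovered v k : ~~ covers v k -> (term v)@_k = 0.
Proof. by move=> nc; rewrite mcoeff_term (mcoeff_outdom nc) mulr0. Qed.

Lemma sum_terms : \sum_i alpha i * xi i = \sum_v term v.
Proof.
under eq_bigr do rewrite gr_mul_sum.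
by rewrite (@sig_big_dep _ _ _ _ _ xpredT (fun _ => xpredT)).
Qed.

Lemma pt_dist g k k' : mdist (pt (g * k)%g) (pt (g * k')%g) = mdist (pt k) (pt k').
Proof. by case: isoG => _ actM actI; rewrite !actM actI. Qed.

Lemma xi_neq0 v k : covers v k -> xi (tag v) != 0.
Proof. by apply: contraTneq => xi0; rewrite /covers xi0 msupp0. Qed.

Lemma diamE i : xi i != 0 -> gr_diam act o (xi i) = (diam i)%:E.
Proof. by move=> /(gr_diam_attained act o)[k [k' [_ _ e _]]]; rewrite /diam e. Qed.

Lemma diam_ge0 i : xi i != 0 -> 0 <= diam i.
Proof.
by move=> /(gr_diam_attained act o)[k [k' [_ _ e _]]]; rewrite /diam e mdist_ge0.
Qed.

Lemma covers_dist v k k' : covers v k -> covers v k' ->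
  mdist (pt k) (pt k') <= diam (tag v).
Proof.
move=> vk vk'; rewrite -(pt_dist (translator v)^-1).
have [l [l' [_ _ e le_l]]] := gr_diam_attained act o (xi_neq0 vk).
by rewrite /diam e; exact: le_l.
Qed.

(** The midpoint of a diametral pair works: by midpoint_dist, one end of the
pair is farther than the midpoint by about [diam i / 2] from any given
point. *)
Lemma center_exists i : xi i != 0 -> exists c : H, forall g,
  {in msupp (xi i), forall k, mdist (act g c) (pt (g * k)%g) <= diam i / 2 + 2 * delta} /\
  forall p, exists2 k, k \in msupp (xi i) &
    mdist (act g c) p <= mdist (pt (g * k)%g) p - diam i / 2 + 2 * delta.
Proof.
move=> xi0; have [k [k' [kx k'x e le_diam]]] := gr_diam_attained act o xi0.
have dE : diam i = mdist (pt k) (pt k') by rewrite /diam e.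
case: hypH => _ geod four _; case: isoG => act1 actM actI.
have [c [kc k'c]] := midpoint_exists (geod (pt k) (pt k')).
have mid u := midpoint_dist delta_ge0 four u (erefl _) kc k'c.
exists c => g; rewrite dE; split.
  move=> l lx; rewrite actM actI metric_sym; apply: le_trans (mid _) _.
  have := le_diam _ _ lx kx; have := le_diam _ _ lx k'x.
  by rewrite maxEle; case: ifP => _; lra.
move=> p.
have actVp : act g (act g^-1%g p) = p by rewrite -actM mulgV act1.
have toV u : mdist (act g u) p = mdist (act g^-1%g p) u.
  by rewrite -{1}actVp actI metric_sym.
have := mid (act g^-1%g p); rewrite -!toV -!actM.
by rewrite maxEle; case: ifP => _ le_c; [exists k' | exists k].
Qed.

Variables (top : V -> G) (v0 : V).
Hypothesis topP : forall v, xi (tag v) != 0 ->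
  covers v (top v) /\ forall k, covers v k -> norm k <= norm (top v).
Hypothesis v0_neq0 : xi (tag v0) != 0.
Local Notation rho := (norm (top v0)).
Hypothesis top_le : forall v, xi (tag v) != 0 -> norm (top v) <= rho.
Hypothesis vanishing : forall k, rho - delta_ delta n <= norm k ->
  (\sum_i alpha i * xi i)@_k = 0.

Definition touch (T : R) : rel V := fun a b =>
  `[< exists k, [/\ covers a k, covers b k & rho - T <= norm k] >].
Definition cluster (T : R) : {set V} := [set v | connect (touch T) v0 v].
(** The height up to which every high point of the translate [v] agrees with
its farthest point [top v]; it differs from [(norm (top v) - diam (tag v)) / 2]
by a constant. *)
Definition lvl (T : R) (v : V) : R := (rho - T + norm (top v) - diam (tag v)) / 2.
Local Notation gp := (fun p q : H => gromov_product p q o).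

Lemma touchC T : symmetric (touch T).
Proof.
by move=> a b; apply/asboolP/asboolP => -[k [ak bk le]]; exists k.
Qed.

Lemma cluster_self T : v0 \in cluster T.
Proof. by rewrite inE connect0. Qed.

Lemma cluster_touch T a b : a \in cluster T -> touch T a b -> b \in cluster T.
Proof.
by rewrite /cluster !finset.inE => v0a ab; apply: connect_trans v0a (connect1 ab).
Qed.

Lemma cluster_mono T T' : T <= T' -> cluster T \subset cluster T'.
Proof.
move=> leT; apply/fintype.subsetP => v; rewrite [v \in cluster T]inE.
apply: (connect_invariant (Inv := fun v => v \in cluster T')); last exact: cluster_self.
move=> a b aC /asboolP[k [ak bk le_k]]; apply: cluster_touch aC _.
by apply/asboolP; exists k; split=> //; lra.
Qed.

Lemma cluster_induced T v : v \in cluster T ->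
  connect (induced (touch T) (cluster T)) v0 v.
Proof.
rewrite inE => v0v.
suff [] : v \in cluster T /\ connect (induced (touch T) (cluster T)) v0 v by [].
apply: (connect_invariant (Inv := fun v => v \in cluster T /\
  connect (induced (touch T) (cluster T)) v0 v) _ _ v0v).
  move=> a b [aC v0a] ab; have bC := cluster_touch aC ab; split=> //.
  by apply: connect_trans v0a (connect1 _); rewrite /induced /= aC bC.
by split; [exact: cluster_self | exact: connect0].
Qed.

Lemma cluster_top T v : 0 <= T -> v \in cluster T ->
  [/\ xi (tag v) != 0, covers v (top v) & rho - T <= norm (top v)].
Proof.
move=> T0; rewrite inE => v0v.
suff [xi0 le] : xi (tag v) != 0 /\ rho - T <= norm (top v).
  by have [] := topP xi0.
apply: (connect_invariant
  (Inv := fun v => xi (tag v) != 0 /\ rho - T <= norm (top v)) _ _ v0v).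
  move=> a b _ /asboolP[k [_ bk le_k]]; have xi0 := xi_neq0 bk; split=> //.
  by have [_ /(_ k bk)] := topP xi0; lra.
by split=> //; lra.
Qed.

Lemma lvl_self T : 0 <= T -> {in cluster T, forall v, lvl T v <= gp (pt (top v)) (pt (top v))}.
Proof.
move=> T0 v /(cluster_top T0)[xi0 _ le_v]; have := diam_ge0 xi0.
by rewrite /lvl /gromov_product mdistxx; lra.
Qed.

Lemma lvl_touch T : 0 <= T -> {in cluster T &, forall a b, touch T a b ->
  exists p, lvl T a <= gp (pt (top a)) p /\ lvl T b <= gp p (pt (top b))}.
Proof.
move=> T0 a b /(cluster_top T0)[_ ca _] /(cluster_top T0)[_ cb _].
move=> /asboolP[k [ak bk le_k]]; exists (pt k).
have := covers_dist ca ak; have := covers_dist bk cb.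
by rewrite /lvl /gromov_product; split; lra.
Qed.

(** Translates of one element have equal diameters, so their centers are
close by centers_close. They are images of a single point, which the group
moves farther than that. The tolerance [4 n + 1] is the excess [2 n + 1] in
height of a long vertex plus the loss [2 n] of gp_connect_linear. *)
Lemma lvl_sep T : 0 <= T <= delta_ delta n ->
  {in cluster T &, forall a b, tag a = tag b -> lvl T a <= lvl T b ->
    lvl T a - (4 * n%:R + 1) * delta <= gp (pt (top a)) (pt (top b)) -> a = b}.
Proof.
move=> /andP[T0 leT] [i ga] [j gb] aC bC /= eqij; subst j.
set a : V := existT _ i ga in aC *; set b : V := existT _ i gb in bC *.
move=> le_ab gp_ab.
have d0 := delta_ge0.
have [xi0 ca le_a] := cluster_top T0 aC; have [_ cb le_b] := cluster_top T0 bC.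
have [c cP] := center_exists xi0.
have near v : tag v = i -> covers v (top v) ->
    mdist (act (translator v) c) (pt (top v)) <= diam i / 2 + 2 * delta /\
    mdist (act (translator v) c) o <= norm (top v) - diam i / 2 + 2 * delta.
  move=> vi cv; have [cdist /(_ o)[k kx le_k]] := cP (translator v); split.
    have kv : ((translator v)^-1 * top v)%g \in msupp (xi i) by rewrite -vi.
    by have := cdist _ kv; rewrite mulKVg.
  have /topP[_ /(_ (translator v * k)%g)] : xi (tag v) != 0 by exact: xi_neq0 cv.
  by rewrite /covers mulKg vi kx => /(_ isT); lra.
have [a1 a2] := near a erefl ca; have [b1 b2] := near b erefl cb.
have n1 : 1 <= n%:R :> R by rewrite ler1n (leq_trans _ (ltn_ord i)).
have nd : delta <= n%:R * delta by rewrite ler_peMl.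
case: hypH => _ _ four _.
have := @centers_close _ _ _ d0 four o _ _ _ _ (diam i) (rho - T)
  ((4 * n%:R + 1) * delta) a1 b1 a2 b2 le_a _ _ gp_ab.
have le_ab' : norm (top a) <= norm (top b) by move: le_ab; rewrite /lvl /=; lra.
have le_D : 2 * delta <= (4 * n%:R + 1) * delta by lra.
have le_rho : norm (top b) <= rho by exact: top_le.
move=> /(_ le_ab' le_D) close.
have [eqt|neqt] := eqVneq (translator b) (translator a).
  by rewrite /a /b; congr existT; apply/val_inj/esym.
have neq1 : (translator b * (translator a)^-1 != 1)%g.
  by apply: contra_neq neqt => ba1; rewrite -[LHS](mulgKV (translator a)) ba1 mul1g.
have := displ (act (translator a) c) neq1.
by case: isoG => _ actM _; rewrite -actM mulgKV metric_sym => gt_dist; exfalso; lra.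
Qed.

(** Minimality of the height of [a] is what makes the linear bound on the
Gromov product reach the tolerance of lvl_sep. *)
Lemma cluster_sep T a b : 0 <= T <= delta_ delta n ->
    a \in cluster T -> {in cluster T, forall v, lvl T a <= lvl T v} ->
    b \in cluster T -> tag a = tag b -> a = b.
Proof.
move=> T0n aC amin bC eqt; have /andP[T0 _] := T0n; have d0 := delta_ge0.
have nd : 0 <= n%:R * delta by rewrite mulr_ge0.
case: hypH => _ _ four _; apply: (lvl_sep T0n); rewrite ?amin //.
have conn : connect (induced (touch T) (cluster T)) a b.
  apply: connect_trans (cluster_induced bC).
  by rewrite induced_connect_sym ?cluster_induced //; exact: touchC.
have le_card : (#|[set tag v | v in cluster T]| <= n)%N.
  by rewrite -[X in (_ <= X)%N]card_ord; exact: max_card.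
have leD : (n%:R * 2) * delta <= (4 * n%:R + 1) * delta by lra.
have := @gp_connect_linear R V 'I_n H (fun p q => gromov_product p q o) delta d0
  (fun p q => gromov_productC p q o) (fun p q s => four p q o s)
  (fun v => pt (top v)) (lvl T) (fun v => tag v) (touch T) (cluster T) _
  (@touchC T) (lvl_self T0) (lvl_touch T0) (lvl_sep T0n) n (cluster T) (lvl T a) a b
  (fintype.subxx _) le_card leD amin aC conn.
by rewrite /=; lra.
Qed.

Lemma cluster_gp T k q a b : 0 <= T <= delta_ delta n ->
    (#|[set tag v | v in cluster T]| <= 2 ^ k)%N ->
    q \in cluster T -> {in cluster T, forall v, lvl T q <= lvl T v} ->
    a \in cluster T -> b \in cluster T ->
  lvl T q - (k%:R + 4) * delta <= gromov_product (pt (top a)) (pt (top b)) o.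
Proof.
move=> T0n le_card qC qmin aC bC; have /andP[T0 _] := T0n; have d0 := delta_ge0.
case: hypH => _ _ four _.
have leD : (4 * #|'I_n|%:R + 1) * delta <= (4 * n%:R + 1) * delta by rewrite card_ord.
apply: (@gp_connect_log R V 'I_n H (fun p q => gromov_product p q o) delta d0
  (fun p q => gromov_productC p q o) (fun p q s => four p q o s)
  (fun v => pt (top v)) (lvl T) (fun v => tag v) (touch T) (cluster T) _ (@touchC T)
  (lvl_self T0) (lvl_touch T0) (lvl_sep T0n) k (cluster T) q a b
  (fintype.subxx _) le_card leD qmin qC) => // v vC.
apply: connect_trans (cluster_induced vC).
by rewrite induced_connect_sym ?cluster_induced //; exact: touchC.
Qed.

(** * Reduction of the diameter *)
Definition labels (T : R) : {set 'I_n} := [set tag v | v in cluster T].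

(** The number of labels [N m] lies between [1] and [n] and grows with [m];
at the least [m.+1] with [N m.+1 <= m.+1] one has [m < N m], which leaves no
room for growth. *)
Lemma stable_level : exists m, [/\ (m < n)%N,
  (#|labels (delta_ delta m.+1)| <= m.+1)%N &
  labels (delta_ delta m.+1) = labels (delta_ delta m)].
Proof.
pose N m := #|labels (delta_ delta m)|.
have N_gt0 m : (0 < N m)%N.
  rewrite card_gt0; apply/finset.set0Pn; exists (tag v0).
  by rewrite imset_f ?cluster_self.
have N_le : exists m, (N m <= m)%N.
  by exists n; rewrite -[X in (_ <= X)%N]card_ord; exact: max_card.
have [[|m] le_m min_m] := ex_minnP N_le; first by have := N_gt0 0%N; lia.
have lt_m : (m < N m)%N by rewrite ltnNge; apply/negP => /min_m; lia.
have sub_m : labels (delta_ delta m) \subset labels (delta_ delta m.+1).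
  by apply: imsetS; apply: cluster_mono; exact: delta_mono.
exists m; split=> //.
  by rewrite -ltnS -[n]card_ord ltnS (leq_trans lt_m) //; exact: max_card.
apply/esym/eqP; rewrite eqEcard sub_m /=; exact: leq_trans lt_m.
Qed.

(** A translate containing a high point of the cluster belongs to the cluster,
so at high points the partial sum and the total sum have the same
coefficient. *)
Lemma cluster_sum_support T k : 0 <= T <= delta_ delta n ->
  k \in msupp (\sum_(v in cluster T) term v) ->
  norm k < rho - T /\ exists2 v, v \in cluster T & covers v k.
Proof.
move=> /andP[T0 leT]; rewrite -mcoeff_neq0 raddf_sum /= => sum_neq0.
have [v vC vk] : exists2 v, v \in cluster T & covers v k.
  apply/exists_inP; apply: contraNT sum_neq0 => /exists_inPn no_v.
  by rewrite big1 // => v /no_v/term_notcovered.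
split; last by exists v.
rewrite ltNge; apply: contraNN sum_neq0 => le_k.
have sum0 : (\sum_i alpha i * xi i)@_k = 0 by apply: vanishing; lra.
apply/eqP; rewrite -[RHS]sum0 sum_terms raddf_sum /= big_mkcond; apply: eq_bigr => w _.
case: ifPn => // wC; apply/esym/term_notcovered/negP => wk.
by case/negP: wC; apply: cluster_touch vC _; apply/asboolP; exists k.
Qed.

(** With [j] the integral part of the logarithm of the number of labels, the
chain loss [j + 5] enters low_points_close twice, together with [4 delta]: the
total [2 j + 14] is one less than the increment of the level. *)
Lemma cluster_sum_diam m q : (m < n)%N ->
    (#|labels (delta_ delta m.+1)| <= m.+1)%N ->
    q \in cluster (delta_ delta m.+1) ->
    {in cluster (delta_ delta m.+1),
      forall v, lvl (delta_ delta m.+1) q <= lvl (delta_ delta m.+1) v} ->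
    rho - delta_ delta m <= norm (top q) ->
  {in msupp (\sum_(v in cluster (delta_ delta m.+1)) term v) &,
    forall k k', mdist (pt k) (pt k') < diam (tag q) - delta}.
Proof.
set T := delta_ delta m.+1 => lt_mn card_m qC qmin le_q k k'.
have d0 := delta_ge0.
have T0n : 0 <= T <= delta_ delta n.
  by rewrite delta_mono // -(delta_0 delta) delta_mono.
have /andP[T0 _] := T0n.
move=> /(cluster_sum_support T0n)[k_lt [v vC vk]].
move=> /(cluster_sum_support T0n)[k'_lt [v' v'C v'k']].
have [_ cv _] := cluster_top T0 vC; have [_ cv' _] := cluster_top T0 v'C.
pose j := trunc_log 2 #|labels T|.
have labels_le : (#|labels T| <= 2 ^ j.+1)%N by apply/ltnW/trunc_log_ltn.
have labels_gt0 : (0 < #|labels T|)%N.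
  by rewrite card_gt0; apply/finset.set0Pn; exists (tag q); rewrite imset_f.
have step : delta_ delta m + (15 + 2 * j%:R) * delta <= T.
  apply: delta_step => //; apply: leq_trans (leqnSn _).
  by apply: leq_trans card_m; exact: trunc_logP.
have qv := qmin _ vC; have qv' := qmin _ v'C; rewrite /lvl in qv qv'.
have E0 : 0 <= (j.+1%:R + 4) * delta by rewrite mulr_ge0 ?addr_ge0.
have := cluster_gp T0n labels_le qC qmin vC v'C.
case: hypH => _ _ four _.
have le_q_v : norm (top q) - diam (tag q) <= norm (top v) - diam (tag v) by lra.
have le_q_v' : norm (top q) - diam (tag q) <= norm (top v') - diam (tag v') by lra.
rewrite /lvl -addrA => gp_vv'.
have := low_points_close d0 four k_lt k'_lt (covers_dist vk cv) (covers_dist v'k' cv')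
  le_q_v le_q_v' E0 gp_vv'.
by rewrite -(natr1 j); lra.
Qed.

Lemma diameter_reduction : exists i0 (beta : 'I_n -> group_ring K G),
  (gr_diam act o (xi i0 + \sum_(i | i != i0) beta i * xi i)%R
     < gr_diam act o (xi i0) - delta%:E)%E.
Proof.
have d0 := delta_ge0.
have [m [lt_mn card_m eq_labels]] := stable_level.
set T := delta_ delta m.+1 in card_m eq_labels.
have T0n : 0 <= T <= delta_ delta n.
  by rewrite delta_mono // -(delta_0 delta) delta_mono.
have leT : delta_ delta m <= T by exact: delta_mono.
have [q qC qmin] : exists2 q, q \in cluster T &
    {in cluster T, forall v, lvl T q <= lvl T v}.
  by case: (arg_minP (lvl T) (cluster_self T)) => q qC qmin; exists q.
have sep v : v \in cluster T -> tag q = tag v -> q = v.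
  by move=> vC; exact: cluster_sep T0n qC qmin vC.
have qC' : q \in cluster (delta_ delta m).
  have : tag q \in labels (delta_ delta m) by rewrite -eq_labels imset_f.
  case/imsetP => v vC' eqt.
  by rewrite (sep v _ eqt) //; apply: (fintype.subsetP (cluster_mono leT)).
have Tm0 : 0 <= delta_ delta m by rewrite -(delta_0 delta) delta_mono.
have [q_neq0 _ le_q] := cluster_top Tm0 qC'.
(* moves the translate [q] back to [xi (tag q)] with coefficient 1 *)
pose u : group_ring K G := << (coef q)^-1 *g (translator q)^-1%g >>.
pose mon v : group_ring K G := << coef v *g translator v >>.
pose beta i := u * \sum_(v in cluster T | tag v == i) mon v.
have beta_q : beta (tag q) = 1.
  rewrite /beta (big_pred1 q) => [|v].
    by rewrite [LHS]gr_mulUU mulVf ?coef_neq0 // mulVg.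
  apply/andP/eqP => [[vC /eqP eqt]|->]; last by rewrite qC.
  exact/esym/sep.
have uE : u * (\sum_(v in cluster T) term v)
    = xi (tag q) + \sum_(i | i != tag q) beta i * xi i.
  rewrite (partition_big (fun v : V => tag v) xpredT) //= mulr_sumr.
  rewrite (bigD1 (tag q)) //=; congr (_ + _).
    rewrite -[RHS]mul1r -beta_q /beta -mulrA mulr_suml; congr (_ * _).
    by apply: eq_bigr => v /andP[_ /eqP eqt]; rewrite /term eqt.
  apply: eq_bigr => i _; rewrite /beta -mulrA mulr_suml; congr (_ * _).
  by apply: eq_bigr => v /andP[_ /eqP eqt]; rewrite /term eqt.
exists (tag q), beta; rewrite diamE // -EFinB -uE; apply: gr_diam_lt.
have supp k : k \in msupp (u * \sum_(v in cluster T) term v) ->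
    (translator q * k)%g \in msupp (\sum_(v in cluster T) term v).
  rewrite -!mcoeff_neq0 mcoeff_mulU invgK; apply: contra_neq => ->.
  by rewrite mulr0.
move=> k k' /supp k_in /supp k'_in; rewrite -(pt_dist (translator q)).
exact: (cluster_sum_diam lt_mn card_m qC qmin le_q).
Qed.

End Clusters.

Theorem theorem12 (R : realType) (n : nat) (n_ge1 : (1 <= n)%N)
    (delta : R) (delta_ge0 : 0 <= delta)
    (K : fieldType) (G : groupType) (H : metricType R)
    (hypH : hyperbolic delta H)
    (act : G -> H -> H) (isoG : isometric_action act) (o : H)
    (displ : ((4 * delta_ delta n + (10 + 2 * n%:R) * delta)%:E
                < min_displacement act)%E)
    (xi : 'I_n -> group_ring K G)
    (hxi : exists alpha : 'I_n -> group_ring K G,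
       (exists i, alpha i != 0) /\
       (gr_abs act o (\sum_i alpha i * xi i)%R
          < \big[maxe/-oo]_i gr_abs act o (alpha i * xi i)%R
            - (delta_ delta n)%:E)%E) :
  let i1 : 'I_n := Ordinal n_ge1 in
  exists (sigma : {perm 'I_n}) (beta : 'I_n -> group_ring K G),
    (gr_diam act o
       (xi (sigma i1) + \sum_(i | i != i1) beta i * xi (sigma i))%R
     < gr_diam act o (xi (sigma i1)) - delta%:E)%E.
Proof.
move=> i1; case: hxi => alpha [_ small].
suff [i0 [beta red]] : exists i0 (beta : 'I_n -> group_ring K G),
    (gr_diam act o (xi i0 + \sum_(i | i != i0) beta i * xi i)%R
       < gr_diam act o (xi i0) - delta%:E)%E.
  exists (tperm i1 i0), (beta \o tperm i1 i0); rewrite tpermL.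
  rewrite (reindex_inj (perm_inj (s := tperm i1 i0))) in red.
  rewrite (eq_bigl (fun i => i != i1)) // in red => i.
  by rewrite -{2}(tpermL i1 i0) (inj_eq perm_inj).
have displ' g p : g != 1%g ->
    delta_ delta n + (8 * n%:R + 10) * delta < mdist (act g p) p.
  move=> g_neq1.
  have : (min_displacement act <= (mdist (act g p) p)%:E)%E.
    by apply: ereal_inf_lbound; exists g => //; exists p.
  move=> /(lt_le_trans displ); rewrite lte_fin.
  (* [delta_ delta n] dominates [15 n delta], so the excess [3 delta_n] of the
     hypothesis absorbs the missing [6 n delta]. *)
  have := @delta_ge15 R delta n delta_ge0.
  have : 0 <= n%:R * delta by rewrite mulr_ge0.
  by lra.
pose V := {i : 'I_n & msupp (alpha i)}.
have /choice[top topP] : forall v : V, exists t, xi (tag v) != 0 ->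
    covers xi v t /\
    forall k, covers xi v k -> mdist (act k o) o <= mdist (act t o) o.
  move=> v; have [xi0|xi_neq0] := eqVneq (xi (tag v)) 0.
    by exists 1%g.
  have supp_neq0 : msupp (xi (tag v)) != [::] :> seq G.
    apply: contra_neq xi_neq0 => supp0; apply/malgP => k; rewrite mcoeff0.
    apply/mcoeff_outdom/negP => kx.
    by have : k \in (msupp (xi (tag v)) : seq G) by []; rewrite supp0.
  have [k kx kmax] := seq_argmax
    (fun k => mdist (act (translator v * k)%g o) o) supp_neq0.
  exists (translator v * k)%g => _; rewrite /covers mulKg; split=> // k' /kmax.
  by rewrite mulKVg.
have product_abs (c : \bar R) :
    (forall (v : V) k, covers xi v k -> (mdist (act k o) o)%:E <= c)%E ->
  (\big[maxe/-oo]_i gr_abs act o (alpha i * xi i)%R <= c)%E.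
  move=> le_c; apply: bigmax_le => [|i _]; first exact: leNye.
  apply: gr_abs_le => k /msupp_mul[g gi gk].
  by apply: (le_c (existT _ i (FSetSub gi) : V) k).
have [v1 v1_neq0] : exists v : V, xi (tag v) != 0.
  apply: contrapT => no_v; suff : (\big[maxe/-oo]_i gr_abs act o (alpha i * xi i)%R <= -oo)%E.
    by rewrite leeNy_eq => /eqP maxN; move: small; rewrite maxN ltNge leNye.
  by apply: product_abs => v k /xi_neq0 xi0; case: no_v; exists v.
have [v0 v0_neq0 top_le] : exists2 v0 : V, xi (tag v0) != 0 &
    forall v : V, xi (tag v) != 0 ->
      mdist (act (top v) o) o <= mdist (act (top v0) o) o.
  case: (arg_maxP (P := [pred v | xi (tag v) != 0])
    (fun v => mdist (act (top v) o) o) v1_neq0) => v0 v00 v0max.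
  by exists v0.
apply: (diameter_reduction delta_ge0 hypH isoG displ' topP v0_neq0 top_le) => k le_k.
apply/eqP; apply: contraLR le_k; rewrite mcoeff_neq0 => /(gr_abs_ge act o) le_k.
rewrite -ltNge -lte_fin; apply: le_lt_trans le_k (lt_le_trans small _).
rewrite EFinB leeD2r //; apply: product_abs => v k' vk'.
have xi0 := xi_neq0 vk'; rewrite lee_fin; apply: le_trans (top_le v xi0).
by have [_] := topP v xi0; apply.
Qed.
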